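(* If $p\ge 2$ is an integer and $q\ge 3$ is an odd integer, then $H_{p,q}$ is a $p$-STI graph.
   Context: The transmission of a vertex $u$ of a connected graph $G$ is $\mathrm{Tr}_G(u)=\sum_{x\in V(G)} d_G(u,x)$, where $d_G$ is the shortest-path distance. For an integer $k\ge 1$, a connected finite simple graph $G$ is a $k$-STI graph if $|\mathrm{Tr}_G(x)-\mathrm{Tr}_G(y)|=k$ for every edge $xy\in E(G)$. Write $[m]=\{1,\dots,m\}$. For $p,q\ge 2$, $H_{p,q}$ is the graph with vertex set $$\{v_i : i\in[2q]\}\cup\{w_{2r-1,j} : r\in[q],\ j\in[p]\}\cup\{w_{2r,j} : r\in[q],\ j\in[2]\}$$ and edge set $A\cup B\cup C$, where $A=\{v_1w_{2q,j} : j\in[2]\}$, $B=\{v_{2r-1}w_{2r-1,j} : r\in[q],\ j\in[p]\}\cup\{v_{2r-1}w_{2r-2,j} : 2\le r\le q,\ j\in[2]\}$, $C=\{v_{2r}w_{2r,j} : r\in[q],\ j\in[2]\}\cup\{v_{2r}w_{2r-1,j} : r\in[q],\ j\in[p]\}$. (Thus copies of $K_{2,p}$ and $K_{2,2}$ alternate in a cyclic structure.) *)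

(* Defs.v *)
From HB Require Import structures.
From mathcomp Require Import all_boot all_order all_algebra.
Set Implicit Arguments.
Unset Strict Implicit.
Unset Printing Implicit Defensive.

(* A finite simple graph is a symmetric irreflexive relation on a finType. *)

Section Graph.
Variables (T : finType) (e : rel T).

Definition simple_graph : Prop := symmetric e /\ irreflexive e.

Definition connected_graph : Prop := forall x y : T, connect e x y.

Definition walk_of_length (n : nat) (x y : T) : bool :=
  [exists s : n.-tuple T, path e x s && (last x s == y)].

(* Shortest-path distance. A shortest walk repeats no vertex, so it has fewer
   than #|T| edges; #|T| is a junk value when y is not reachable from x. *)
Definition gdist (x y : T) : nat :=
  find (fun n => walk_of_length n x y) (iota 0 #|T|).

Definition transmission (u : T) : nat := \sum_(x : T) gdist u x.

(* `|m - n|%N is the absolute value of the signed integer difference. *)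
Definition STI (k : nat) : Prop :=
  [/\ 0 < k, simple_graph, connected_graph &
      forall x y : T, e x y -> `|transmission x - transmission y|%N = k].

End Graph.

(* Ordinals count from 0 and the indices of H_{p,q} from 1: V i is v_{i+1},
   Wodd r j is w_{2(r+1)-1,j+1} and Weven r j is w_{2(r+1),j+1}. *)
Inductive Hvertex (p q : nat) : Type :=
  | V of 'I_(2 * q)
  | Wodd of 'I_q & 'I_p
  | Weven of 'I_q & 'I_2.

Arguments V {p q} _.
Arguments Wodd {p q} _ _.
Arguments Weven {p q} _ _.

Section HvertexFinType.
Variables p q : nat.

Definition Hvertex_code (x : Hvertex p q) :
    'I_(2 * q) + ('I_q * 'I_p + 'I_q * 'I_2) :=
  match x with
  | V i => inl i
  | Wodd r j => inr (inl (r, j))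
  | Weven r j => inr (inr (r, j))
  end.

Definition Hvertex_decode (c : 'I_(2 * q) + ('I_q * 'I_p + 'I_q * 'I_2)) :
    Hvertex p q :=
  match c with
  | inl i => V i
  | inr (inl (r, j)) => Wodd r j
  | inr (inr (r, j)) => Weven r j
  end.

Lemma Hvertex_codeK : cancel Hvertex_code Hvertex_decode.
Proof. by case. Qed.

HB.instance Definition _ := Finite.copy (Hvertex p q) (can_type Hvertex_codeK).

End HvertexFinType.

Definition index1 (n : nat) (i : 'I_n) : nat := i.+1.

Section H.
Variables p q : nat.
Implicit Types x y : Hvertex p q.

(* EA, EB and EC are the edge sets A, B and C, each edge read from its
   endpoint v_i to its endpoint w_{s,j}. *)

Definition EA x y : bool :=
  match x, y with
  | V i, Weven r _ => (index1 i == 1) && (2 * index1 r == 2 * q)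
  | _, _ => false
  end.

Definition EB x y : bool :=
  match x, y with
  | V i, Wodd r _ => index1 i == 2 * index1 r - 1
  | V i, Weven r _ =>
      [exists s : 'I_q, [&& 2 <= index1 s, index1 i == 2 * index1 s - 1
                          & 2 * index1 r == 2 * index1 s - 2]]
  | _, _ => false
  end.

Definition EC x y : bool :=
  match x, y with
  | V i, Weven r _ => index1 i == 2 * index1 r
  | V i, Wodd r _ => index1 i == 2 * index1 r
  | _, _ => false
  end.

Definition Hedge : rel (Hvertex p q) :=
  fun x y => [|| EA x y, EB x y, EC x y, EA y x, EB y x | EC y x].

End H.

(* Main.v *)
(** [H_{p,q}] is a blow-up of the cycle of length [4q]: the vertex [v_i] sits
    alone at an even position, and the classes [w_{s,_}] sit at the odd
    positions, with [p] and [2] elements alternately. So two distinct vertices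
    are at the cyclic distance of their positions, or at distance 2 if they
    share a position. Hence, counting each vertex at distance 2 from itself,
    the distances from a given vertex to the positions of a residue class
    modulo 4 add up, for odd [q], to [q^2] if the class has the other parity
    and to [q^2 + 1] if it has the same parity. Therefore
    [Tr v = 2 (q^2 + 1) + (p + 2) q^2 - 2] and
    [Tr w = 2 q^2 + (p + 2) (q^2 + 1) - 2], which differ by [p]. *)
Require Import Defs.
From mathcomp Require Import all_boot.
From mathcomp Require Import zify ring.

Set Implicit Arguments.
Unset Strict Implicit.
Unset Printing Implicit Defensive.

(** * Recognising the shortest-path distance by local conditions *)

Section DistanceCharacterization.
Variables (T : finType) (e : rel T) (D : T -> T -> nat).
Hypothesis D_refl : forall x, D x x = 0.
Hypothesis D_edge : forall x y z, e x y -> D x z <= (D y z).+1.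
Hypothesis D_descent :
  forall x z, x != z -> exists2 y, e x y & D x z = (D y z).+1.

Lemma dist_le_path x s : path e x s -> D x (last x s) <= size s.
Proof.
elim: s x => [|y s IHs] x /=; first by rewrite D_refl.
by case/andP=> exy /IHs le_s; apply: leq_trans (D_edge _ exy) _.
Qed.

(** Greedy descent: [D_descent] supplies edges that lower [D] by one until it reaches 0. *)
Lemma path_of_dist x z :
  exists2 s, path e x s & last x s = z /\ size s = D x z.
Proof.
move Dn: (D x z) => n; elim: n => [|n IHn] in x Dn *.
  case: (eqVneq x z) => [<-|/D_descent[y _]]; last by rewrite Dn.
  by exists [::].
case: (eqVneq x z) => [xz|/D_descent[y exy]].
  by move: Dn; rewrite xz D_refl.
rewrite Dn => -[/esym/IHn[s es [lz sz]]].
by exists (y :: s); rewrite /= ?exy ?sz.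
Qed.

Lemma connected_of_dist : connected_graph e.
Proof.
by move=> x z; have [s es [lz _]] := path_of_dist x z; apply/connectP; exists s.
Qed.

(** A walk of length [D x z] shortens to one without repeated vertices. The bound ensures that
    [find] in [gdist] does not return its default. *)
Lemma dist_lt_card x z : D x z < #|T|.
Proof.
have [s es [<- _]] := path_of_dist x z.
case/shortenP: es => s' es' us' _.
apply: leq_ltn_trans (dist_le_path es') _.
by rewrite -[_.+1]/(size (x :: s')) -(card_uniqP us') max_card.
Qed.

Lemma walk_of_dist x z : walk_of_length e (D x z) x z.
Proof.
have [s es [lz sz]] := path_of_dist x z.
by apply/existsP; exists (tcast sz (in_tuple s)); rewrite val_tcast es lz /=.
Qed.

Lemma gdistE x z : gdist e x z = D x z.
Proof.
have ltD := dist_lt_card x z; rewrite /gdist.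
set P := fun n => _; have lt_find : find P (iota 0 #|T|) < #|T|.
  rewrite -[X in _ < X](size_iota 0) -has_find; apply/hasP; exists (D x z).
    by rewrite mem_iota.
  exact: walk_of_dist.
apply/eqP; rewrite eqn_leq; apply/andP; split.
  rewrite leqNgt; apply/negP => /(before_find 0).
  by rewrite nth_iota // add0n /P walk_of_dist.
have := lt_find; rewrite -[X in _ < X](size_iota 0) -has_find.
move/(nth_find 0); rewrite nth_iota // add0n => /existsP[s /andP[es /eqP lz]].
by have := dist_le_path es; rewrite lz size_tuple.
Qed.

End DistanceCharacterization.

(** * Sums of cyclic distances over a residue class modulo 4 *)

Lemma sum_shift_periodic (f : nat -> nat) n s :
  (forall i, f (i + n) = f i) -> \sum_(i < n) f (i + s) = \sum_(i < n) f i.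
Proof.
move=> fP; elim: s => [|s IHs]; first by under eq_bigr do rewrite addn0.
(* With [f s] added, both sides become the sum of [f] from [s] to [s + n], split off at the first or
   at the last term. *)
rewrite -IHs; apply: (@addnI (f s)).
have -> : f s + \sum_(i < n) f (i + s.+1) = \sum_(i < n.+1) f (i + s).
  rewrite big_ord_recl; congr (_ + _).
  by apply: eq_bigr => i _; rewrite /= /bump /= addnS add1n.
by rewrite big_ord_recr /= [n + s]addnC fP addnC.
Qed.

Lemma sum_pair_ends (f : nat -> nat) k :
  \sum_(i < (2 * k).+1) f i = f k + \sum_(i < k) (f i + f (2 * k - i)).
Proof.
have -> : (2 * k).+1 = k + 1 + k by lia.
rewrite !big_split_ord /= big_ord1 addn0 big_split /=.
rewrite [X in _ + X](reindex_inj rev_ord_inj) /= addnAC addnC.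
congr (_ + (_ + _)); apply: eq_bigr => i _.
by congr f; have := ltn_ord i; lia.
Qed.

Lemma sum_double (f : nat -> nat) n :
  \sum_(i < 2 * n) f i = \sum_(r < n) (f (2 * r) + f (2 * r).+1).
Proof.
elim: n => [|n IHn]; first by rewrite !big_ord0.
by rewrite mulnS !big_ord_recr /= IHn addnA.
Qed.

(* The value 2 at the multiples of [N] is the distance between two distinct
   vertices sharing a position. *)
Definition ldist (N n : nat) : nat :=
  let m := n %% N in if m == 0 then 2 else minn m (N - m).

Lemma ldist_periodic N n : ldist N (n + N) = ldist N n.
Proof. by rewrite /ldist modnDr. Qed.

Lemma ldist_small N n : n < N ->
  ldist N n = if n == 0 then 2 else minn n (N - n).
Proof. by move=> ltnN; rewrite /ldist modn_small. Qed.

Lemma sum_ldist q n : 3 <= q -> odd q ->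
  \sum_(r < q) ldist (4 * q) (4 * r + n) = q ^ 2 + ~~ odd n.
Proof.
move=> q_ge3 q_odd; rewrite (divn_eq n 4) oddD oddM andbF /=.
set s := n %/ 4; set e := n %% 4; have lt_e4 : e < 4 by rewrite ltn_mod.
pose f r := ldist (4 * q) (4 * r + e).
rewrite (eq_bigr (fun r : 'I_q => f (r + s))); last first.
  by move=> r _; rewrite /f; congr ldist; lia.
rewrite sum_shift_periodic => [|i]; last first.
  by rewrite /f -(ldist_periodic _ (4 * i + e)); congr ldist; lia.
have [k Dq] : exists k, q = (2 * k).+1 by exists q./2; lia.
have k_gt0 : 0 < k by lia.
rewrite Dq sum_pair_ends -Dq.
(* Opposite terms lie on the two sides of the antipode, with values [4 * i + e] and [4 * i + 4 - e].
   The correction is for [ldist] being 2 instead of 0 at 0. *)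
rewrite (eq_bigr (fun i : 'I_k =>
  8 * i + 4 + 2 * ((i == 0 :> nat) && (e == 0)))).
  have -> : \sum_(i < k) (8 * i + 4 + 2 * ((i == 0 :> nat) && (e == 0)))
            = 4 * k ^ 2 + 2 * (e == 0).
    elim: k k_gt0 {Dq} => // -[|k] IHk _; first by rewrite big_ord1 /=; lia.
    by rewrite big_ord_recr /= IHk //; ring.
  (* The antipode is [2 * q = 4 * k + 2], so only [e = 3] passes it. *)
  have -> : f k = if e == 3 then 4 * k + 1 else 4 * k + e.
    by rewrite /f ldist_small; do ?case: eqP; lia.
  rewrite Dq.
  by case: e lt_e4 {f} => [|[|[|[|]]]] //= _; ring.
move=> i _; have ltik := ltn_ord i.
by rewrite /f !ldist_small; do ?case: eqP; lia.
Qed.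

(** * Positions, distances and transmissions in the blown-up cycle *)

Section Blowup.
Variables p q : nat.

Local Notation N := (4 * q).
Implicit Types x y z : Hvertex p q.

Definition pos x : nat :=
  match x with
  | V i => 2 * i
  | Wodd r _ => 4 * r + 1
  | Weven r _ => 4 * r + 3
  end.

Lemma pos_lt x : pos x < N.
Proof. by case: x => [[i ?]|[r ?] j|[r ?] j] /=; lia. Qed.

Lemma pos_surj a : 0 < p -> a < N -> exists x, pos x = a.
Proof.
move=> p_gt0 aN.
have rq : a %/ 4 < q by lia.
have iq : a %/ 2 < 2 * q by lia.
case: (boolP (odd a)) => a_odd; last by exists (V (Ordinal iq)) => /=; lia.
case: (boolP (a %% 4 == 1)) => a1.
  by exists (Wodd (Ordinal rq) (Ordinal p_gt0)) => /=; lia.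
by exists (Weven (Ordinal rq) ord0) => /=; lia.
Qed.

Definition cycle_adj (a b : nat) : bool :=
  [|| b == a.+1, a == b.+1, (a == 0) && (b == N.-1) | (b == 0) && (a == N.-1)].

Lemma EB_Weven (i : 'I_(2 * q)) (r : 'I_q) (j : 'I_2) :
  EB (V i) (Weven r j : Hvertex p q) = (val i == 2 * r + 2).
Proof.
rewrite /EB /index1; have lti := ltn_ord i.
apply/existsP/idP => [[s /and3P[]]|]; first by rewrite /=; lia.
move=> /= /eqP ir; have ltr : r.+1 < q by lia.
by exists (Ordinal ltr) => /=; rewrite ir; lia.
Qed.

Lemma HedgeE x y : Hedge x y = cycle_adj (pos x) (pos y).
Proof.
have lx := pos_lt x; have ly := pos_lt y; move: lx ly; rewrite /Hedge.
case: x y => [i|r j|r j] [i'|r' j'|r' j'];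
  rewrite ?EB_Weven /cycle_adj /EA /EB /EC /index1 /=; lia.
Qed.

(** Adding [N] keeps the truncated subtraction exact; [ldist] has period [N]. *)
Definition Hdist x y : nat :=
  if x == y then 0 else ldist N (pos y + (N - pos x)).

Lemma Hdist_pos x y : x != y ->
  Hdist x y = if pos x == pos y then 2 else
    minn (pos x - pos y + (pos y - pos x))
         (N - (pos x - pos y + (pos y - pos x))).
Proof.
rewrite /Hdist => /negbTE->; have := pos_lt x; have := pos_lt y.
move: (pos x) (pos y) => a b bN aN.
case: (leqP a b) => [ab|ba].
  have -> : b + (N - a) = b - a + N by lia.
  by rewrite ldist_periodic ldist_small; do ?case: eqP; lia.
by rewrite ldist_small; do ?case: eqP; lia.
Qed.

Lemma Hdist_refl x : Hdist x x = 0.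
Proof. by rewrite /Hdist eqxx. Qed.

Lemma Hdist_edge x y z : Hedge x y -> Hdist x z <= (Hdist y z).+1.
Proof.
rewrite HedgeE /cycle_adj => exy.
have [[lx ly] lz] := (pos_lt x, pos_lt y, pos_lt z).
case: (eqVneq x z) => [->|xz]; first by rewrite Hdist_refl.
rewrite (Hdist_pos xz); case: (eqVneq y z) => [yz|yz].
  by rewrite -yz Hdist_refl; case: eqP; lia.
by rewrite (Hdist_pos yz); do 2?case: eqP; lia.
Qed.

Lemma Hdist_descent x z :
  0 < p -> 1 < q -> x != z -> exists2 y, Hedge x y & Hdist x z = (Hdist y z).+1.
Proof.
move=> p_gt0 q_gt1 xz; have [lx lz] := (pos_lt x, pos_lt z).
have [c cN [adj_c dc]] : exists2 c, c < N & cycle_adj (pos x) c /\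
    Hdist x z = (minn (c - pos z + (pos z - c))
                      (N - (c - pos z + (pos z - c)))).+1.
  rewrite (Hdist_pos xz) /cycle_adj; move: (pos x) (pos z) lx lz => a b aN bN.
  (* The sum of the two truncated differences is the absolute difference. The test asks whether
     going up from [a] is a shortest way to [b]; if [a = b], either direction would do. *)
  case: (boolP ((a <= b) == (a - b + (b - a) <= 2 * q))) => fwd.
    by case: (ltnP a.+1 N) => [lt|ge]; [exists a.+1 | exists 0];
      do ?case: eqP; lia.
  by case: (posnP a) => [a0|a_gt0]; [exists N.-1 | exists a.-1];
    do ?case: eqP; lia.
(* At the position of [z] the formula for [c] gives 0, which only [z] itself attains: other vertices
   there are at distance 2. *)
case: (eqVneq c (pos z)) => [cz|cz].
  exists z; first by rewrite HedgeE -cz.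
  by rewrite dc Hdist_refl cz; lia.
have [y yc] := pos_surj p_gt0 cN.
exists y; first by rewrite HedgeE yc.
have yz : y != z by apply: contra_neq cz => <-.
by rewrite (Hdist_pos yz) yc (negbTE cz).
Qed.

Lemma sum_pos (F : nat -> nat) :
  \sum_(x : Hvertex p q) F (pos x) =
    \sum_(r < q) F (4 * r) + \sum_(r < q) F (4 * r + 2)
    + p * \sum_(r < q) F (4 * r + 1) + 2 * \sum_(r < q) F (4 * r + 3).
Proof.
rewrite (reindex (@Hvertex_decode p q)) /=; last first.
  exists (@Hvertex_code p q) => x _; last exact: Hvertex_codeK.
  by case: x => [|[[]|[]]].
(* The vertices [V i] fill the even positions, which split into the residues 0 and 2 modulo 4. *)
rewrite !big_sumType /= (sum_double (fun i => F (2 * i))) big_split /=.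
rewrite -!addnA; congr (_ + (_ + _)).
- by apply: eq_bigr => r _; congr F; lia.
- by apply: eq_bigr => r _; congr F; lia.
have sum_class n (G : nat -> nat) :
    \sum_(c : 'I_q * 'I_n) G c.1 = n * \sum_(r < q) G r.
  rewrite -(pair_bigA _ (fun (r : 'I_q) (_ : 'I_n) => G r)) /= big_distrr /=.
  by apply: eq_bigr => r _; rewrite sum_nat_const card_ord.
rewrite -(sum_class p (fun r => F (4 * r + 1))).
rewrite -(sum_class 2 (fun r => F (4 * r + 3))).
by congr (_ + _); apply: eq_bigr => -[].
Qed.

Lemma transmissionE x : 0 < p -> 3 <= q -> odd q ->
  transmission (@Hedge p q) x + 2
  = 2 * (q ^ 2 + ~~ odd (pos x)) + (p + 2) * (q ^ 2 + odd (pos x)).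
Proof.
move=> p_gt0 q_ge3 q_odd; have q_gt1 := ltnW q_ge3.
have gdistE := gdistE Hdist_refl Hdist_edge
  (fun x z => @Hdist_descent x z p_gt0 q_gt1).
(* The added 2 is the value of [ldist] at [x] itself, so the sum can run over all vertices
   uniformly. *)
have -> : transmission (@Hedge p q) x + 2
          = \sum_y ldist N (pos y + (N - pos x)).
  rewrite /transmission (bigD1 x) //= [RHS](bigD1 x) //=.
  rewrite gdistE Hdist_refl add0n addnC.
  congr (_ + _).
    by rewrite subnKC ?(ltnW (pos_lt x)) // /ldist modnn.
  apply: eq_bigr => y yx.
  by rewrite gdistE /Hdist eq_sym (negbTE yx).
rewrite (sum_pos (fun b => ldist N (b + (N - pos x)))).
have sumE c : \sum_(r < q) ldist N (4 * r + c + (N - pos x))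
              = q ^ 2 + ~~ odd (c + pos x).
  under eq_bigr do rewrite -addnA.
  rewrite sum_ldist //; congr (_ + ~~ _).
  by rewrite !oddD oddB ?(ltnW (pos_lt x)) // oddM.
rewrite sum_ldist // !sumE oddB ?(ltnW (pos_lt x)) // oddM !oddD /=.
by case: (odd _) => /=; ring.
Qed.

Lemma Hedge_irrefl : irreflexive (@Hedge p q).
Proof. by move=> x; have := pos_lt x; rewrite HedgeE /cycle_adj; lia. Qed.

Lemma Hedge_sym : symmetric (@Hedge p q).
Proof. by move=> x y; rewrite !HedgeE /cycle_adj; lia. Qed.

(** The cycle length [N] is even, so the wrap-around edges change parity too. *)
Lemma Hedge_parity x y : Hedge x y -> odd (pos y) = ~~ odd (pos x).
Proof.
by rewrite HedgeE /cycle_adj; have [] := (pos_lt x, pos_lt y); lia.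
Qed.

End Blowup.

Theorem proposition4p3 (p q : nat) (hp : 2 <= p) (hq : 3 <= q)
    (hodd : odd q) : STI (@Hedge p q) p.
Proof.
have p_gt0 := ltnW hp; have q_gt1 := ltnW hq.
split=> //.
- by split; [apply: Hedge_sym | apply: Hedge_irrefl].
- apply: (connected_of_dist (@Hdist_refl p q)) => x z.
  exact: Hdist_descent.
move=> x y exy; have := transmissionE x p_gt0 hq hodd.
have := transmissionE y p_gt0 hq hodd; rewrite (Hedge_parity exy) negbK.
move: (transmission _ x) (transmission _ y) (q ^ 2) => m n Q.
by case: (odd _) => /= hn hm; lia.
Qed.
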